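(* Let $V$ be an $\ell$-Volterra quadratic stochastic operator on $S^{m-1}$ with associated coefficients $a_{ki}$. Let $1\le r\le \ell$, $r<m$, and suppose $a_{ki}<0$ for all $k=1,\dots,r$ and $i=r+1,\dots,m$. Then $$\varphi(x)=x_1+\dots+x_r$$ is a Lyapunov function for $V$. Moreover $\sum_{n=0}^\infty\varphi(x^{(n)})<+\infty$ for any trajectory $\{x^{(n)}\}$ with initial point $x^0\in\mathrm{int}\,S^{m-1}$.
   Context: Let $E=\{1,\dots,m\}$, $S^{m-1}=\{x\in\mathbb{R}^m: x_i\ge 0,\ \sum_{i=1}^m x_i=1\}$, $\mathrm{int}\,S^{m-1}=\{x\in S^{m-1}:\prod_{i=1}^m x_i>0\}$. A quadratic stochastic operator is a map $V:S^{m-1}\to S^{m-1}$, $V(x)_k=\sum_{i,j=1}^m P_{ij,k}x_ix_j$, where $P_{ij,k}\ge 0$, $P_{ij,k}=P_{ji,k}$, $\sum_{k=1}^m P_{ij,k}=1$ for all $i,j,k\in E$. For a fixed $\ell\in E$, $V$ is called $\ell$-Volterra if (i) $P_{ij,k}=0$ whenever $k\in\{1,\dots,\ell\}$, $i,j\in E$ and $k\notin\{i,j\}$; and (ii) for every $k\in\{\ell+1,\dots,m\}$ there is at least one pair $(i,j)$ with $i\ne k$, $j\ne k$ and $P_{ij,k}>0$. Its associated coefficients are $a_{ki}=2P_{ik,k}-1$ for $k\ne i$ and $a_{kk}=P_{kk,k}-1$ ($k,i\in E$). For $k\le\ell$ one then has $V(x)_k=x_k(1+\sum_{i=1}^m a_{ki}x_i)$.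 The trajectory of $x^0$ is $x^{(0)}=x^0$, $x^{(n+1)}=V(x^{(n)})$. A continuous function $\varphi:\mathrm{int}\,S^{m-1}\to\mathbb{R}$ is called a Lyapunov function for $V$ if $\lim_{n\to\infty}\varphi(x^{(n)})$ exists (as a real number) for any initial point $x^0\in\mathrm{int}\,S^{m-1}$; here $\varphi$ is evaluated on all of $S^{m-1}$ by the same formula. *)

(* Defs.v *)
From mathcomp Require Import all_boot all_order all_algebra.
From mathcomp Require Import all_classical all_reals all_analysis.

Set Implicit Arguments.
Unset Strict Implicit.
Unset Printing Implicit Defensive.

Import Order.TTheory GRing.Theory Num.Theory.
Import numFieldNormedType.Exports.

Local Open Scope classical_set_scope.
Local Open Scope ring_scope.

(* Coordinates are numbered from 0: the index set {1, ..., m} is 'I_m, and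
   "k <= l" for a 1-based index k reads "k < l" for the 0-based k : 'I_m.
   S^(m-1) is a subset of the row vectors 'rV_m. *)

Definition simplex (R : realType) (m : nat) : set 'rV[R]_m :=
  [set x | (forall i, 0 <= x 0 i) /\ \sum_i x 0 i = 1].

Definition int_simplex (R : realType) (m : nat) : set 'rV[R]_m :=
  [set x | simplex x /\ 0 < \prod_i x 0 i].

(* qso_coef V i j k is P_{ij,k}. *)
Record qso (R : realType) (m : nat) := QSO {
  qso_coef : 'I_m -> 'I_m -> 'I_m -> R;
  qso_coef_ge0 : forall i j k, 0 <= qso_coef i j k;
  qso_coef_sym : forall i j k, qso_coef i j k = qso_coef j i k;
  qso_coef_sum1 : forall i j, \sum_k qso_coef i j k = 1
}.

(* The formula is applied to all of 'rV_m; qso_map_simplex below shows that it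
   restricts to a self-map of the simplex. *)
Definition qso_map (R : realType) (m : nat) (V : qso R m) (x : 'rV[R]_m) :
    'rV[R]_m :=
  \row_k \sum_i \sum_j qso_coef V i j k * x 0 i * x 0 j.

Lemma qso_map_simplex (R : realType) (m : nat) (V : qso R m) (x : 'rV[R]_m) :
  simplex x -> simplex (qso_map V x).
Proof.
move=> [x_ge0 x_sum1]; split=> [k|].
  rewrite mxE; apply: sumr_ge0 => i _; apply: sumr_ge0 => j _.
  by rewrite !mulr_ge0 // qso_coef_ge0.
under eq_bigr do rewrite mxE.
rewrite exchange_big /= -[RHS]x_sum1; apply: eq_bigr => i _.
rewrite exchange_big /= -[RHS]mulr1 -x_sum1 mulr_sumr; apply: eq_bigr => j _.
by rewrite -!mulr_suml qso_coef_sum1 mul1r.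
Qed.

Definition l_volterra (R : realType) (m l : nat) (V : qso R m) : Prop :=
  (forall k : 'I_m, (k < l)%N ->
     forall i j : 'I_m, k != i -> k != j -> qso_coef V i j k = 0) /\
  (forall k : 'I_m, (l <= k)%N ->
     exists i j : 'I_m, [/\ i != k, j != k & 0 < qso_coef V i j k]).

(* volterra_coef V k i is a_{ki}. *)
Definition volterra_coef (R : realType) (m : nat) (V : qso R m) (k i : 'I_m) :
    R :=
  if k == i then qso_coef V k k k - 1 else 2 * qso_coef V i k k - 1.

Definition trajectory (R : realType) (m : nat) (V : qso R m) (x0 : 'rV[R]_m)
    (n : nat) : 'rV[R]_m :=
  iter n (qso_map V) x0.

(* phi is a total function on 'rV_m because it is evaluated along whole
   trajectories, which may leave the interior of the simplex; continuity is
   only required on the interior. *)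
Definition lyapunov_function (R : realType) (m : nat) (V : qso R m)
    (phi : 'rV[R]_m -> R) : Prop :=
  {within @int_simplex R m, continuous phi} /\
  (forall x0, int_simplex x0 ->
     exists L : R, phi (trajectory V x0 n) @[n --> \oo] --> L).

Definition partial_mass (R : realType) (m r : nat) (x : 'rV[R]_m) : R :=
  \sum_(i < m | (i < r)%N) x 0 i.

(* Main.v *)
Require Import Defs.
From mathcomp Require Import all_boot all_order all_algebra.
From mathcomp Require Import all_classical all_reals all_analysis.
From mathcomp Require Import ring lra.

Set Implicit Arguments.
Unset Strict Implicit.
Unset Printing Implicit Defensive.

Import Order.TTheory GRing.Theory Num.Theory.
Import numFieldNormedType.Exports.

Local Open Scope classical_set_scope.
Local Open Scope ring_scope.

(** Let f be the mass of the first r coordinates. Under V, a pair (i, j) of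
    types sends to the block of the first r types a fraction Q i j = \sum_(k <
    r) P i j k of its mass x_i * x_j ([block_coef]). The Volterra condition
    makes Q vanish when neither type is in the block, and reduces it to P i j i
    = (1 + a_ij) / 2 when i is in the block and j is not. As the a_ij of this
    kind are finitely many and negative, there is one q < 1 with P i j i <= q /
    2 for all of them, and pairs inside the block have Q <= 1; summing over all
    pairs ([partial_mass_qso_map_le]),

      f (V x) <= f x ^ 2 + q * f x * (1 - f x) = (q + (1 - q) * f x) * f x.

    So f does not increase along a trajectory.  An interior starting point has
    p := f x0 < 1, because r < m, hence f never exceeds p, the factor above is
    at most s := q + (1 - q) * p < 1, and f contracts at least by s at each step
    ([partial_mass_trajectory_contract]).  The limit exists by monotonicity and
    the series is dominated by a telescoping sum ([nneseries_contract_lty]). *)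

Section PartialMass.
Variables (R : realType) (m r : nat).
Implicit Types x : 'rV[R]_m.

Lemma partial_mass_ge0 x : simplex x -> 0 <= partial_mass r x.
Proof. by move=> [x0 _]; apply: sumr_ge0. Qed.

Lemma partial_massE x :
  partial_mass r x = \sum_(i < m) ((i < r)%N)%:R * x 0 i.
Proof.
rewrite /partial_mass big_mkcond /=; apply: eq_bigr => i _.
by case: (i < r)%N; rewrite ?mul1r ?mul0r.
Qed.

Lemma partial_mass_lt1 x : (r < m)%N -> int_simplex x -> partial_mass r x < 1.
Proof.
move=> rm [[x_ge0 x_sum1] x_gt0].
have xr_gt0 : 0 < x 0 (Ordinal rm).
  rewrite lt_neqAle x_ge0 andbT; apply: contraTneq x_gt0 => xr0.
  by rewrite (bigD1 (Ordinal rm)) //= -xr0 mul0r ltxx.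
rewrite -x_sum1 [ltRHS](bigID (fun i : 'I_m => (i < r)%N)) /= ltrDl.
rewrite (bigD1 (Ordinal rm)) /= ?ltnn //.
by rewrite ltr_pwDl // sumr_ge0.
Qed.

Lemma continuous_partial_mass : continuous (@partial_mass R m r).
Proof.
apply: continuous_big => [|i _]; last exact: coord_continuous.
exact: add_continuous.
Qed.

End PartialMass.

Section OneStep.
Variables (R : realType) (m l r : nat) (V : qso R m).
Hypotheses (hV : l_volterra l V) (rl : (r <= l)%N).
Implicit Types (i j k : 'I_m) (x : 'rV[R]_m).

Definition block_coef i j : R := \sum_(k < m | (k < r)%N) qso_coef V i j k.

Lemma partial_mass_qso_map x :
  partial_mass r (qso_map V x) =
  \sum_i \sum_j block_coef i j * (x 0 i * x 0 j).
Proof.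
rewrite /partial_mass; under eq_bigr do rewrite mxE.
rewrite exchange_big; apply: eq_bigr => i _ /=.
rewrite exchange_big; apply: eq_bigr => j _ /=.
by rewrite mulr_suml; apply: eq_bigr => k _; rewrite mulrA.
Qed.

Lemma block_coef_le1 i j : block_coef i j <= 1.
Proof.
rewrite -(qso_coef_sum1 V i j) [leRHS](bigID (fun k : 'I_m => (k < r)%N)) /=.
by rewrite lerDl sumr_ge0 // => k _; exact: qso_coef_ge0.
Qed.

Lemma block_coefC i j : block_coef i j = block_coef j i.
Proof. by apply: eq_bigr => k _; exact: qso_coef_sym. Qed.

Lemma block_coef_out i j : (r <= i)%N -> (r <= j)%N -> block_coef i j = 0.
Proof.
move=> ri rj; apply: big1 => k kr; apply: hV.1; first exact: leq_trans rl.
- by apply: contraTneq kr => ->; rewrite -leqNgt.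
- by apply: contraTneq kr => ->; rewrite -leqNgt.
Qed.

Lemma block_coef_mixed i j :
  (i < r)%N -> (r <= j)%N -> block_coef i j = (1 + volterra_coef V i j) / 2.
Proof.
move=> ir rj.
have ij : i != j by apply: contraTneq ir => ->; rewrite -leqNgt.
rewrite /block_coef (bigD1 i) //= big1 ?addr0 => [|k /andP[kr ki]].
  by rewrite /volterra_coef (negbTE ij) (qso_coef_sym V j i); field.
apply: hV.1 => //; first exact: leq_trans rl.
by apply: contraTneq kr => ->; rewrite -leqNgt.
Qed.

(** Finiteness of the index set turns the negativity of each a_ki into a
    uniform gap, here 1 - q. *)
Lemma exists_block_rate :
  (forall k i, (k < r)%N -> (r <= i)%N -> volterra_coef V k i < 0) ->
  exists2 q : R, q < 1 &
    forall i j, (i < r)%N -> (r <= j)%N -> block_coef i j <= q / 2.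
Proof.
move=> a_lt0.
pose mixed (ij : 'I_m * 'I_m) := (ij.1 < r)%N && (r <= ij.2)%N.
exists (\big[Order.max/0]_(ij | mixed ij) (1 + volterra_coef V ij.1 ij.2)).
  apply: bigmax_lt => // -[i j] /andP[/= ir rj].
  by rewrite gtrDl a_lt0.
move=> i j ir rj; rewrite block_coef_mixed // ler_pM2r ?invr_gt0 //.
by apply: (@le_bigmax_cond _ _ _ _ (i, j)); rewrite /mixed ir.
Qed.

Lemma partial_mass_qso_map_le (q : R) x :
  (forall i j, (i < r)%N -> (r <= j)%N -> block_coef i j <= q / 2) ->
  simplex x ->
  partial_mass r (qso_map V x)
    <= (q + (1 - q) * partial_mass r x) * partial_mass r x.
Proof.
move=> hq [x_ge0 x_sum1]; set f := partial_mass r x.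
pose u i : R := ((i < r)%N)%:R.
(* The right-hand side is itself a quadratic form in x, once 1 is written as
   \sum_i x 0 i; its coefficients dominate block_coef pair by pair. *)
have -> : (q + (1 - q) * f) * f =
    \sum_i \sum_j (q / 2 * (u i + u j) + (1 - q) * (u i * u j))
                    * (x 0 i * x 0 j).
  have fE : f = \sum_i u i * x 0 i by exact: partial_massE.
  transitivity (\sum_i ((q / 2 + (1 - q) * f) * (u i * x 0 i)
                         + q / 2 * f * x 0 i)).
    by rewrite big_split /= -!mulr_sumr -fE x_sum1; field.
  apply: eq_bigr => i _.
  transitivity (\sum_j (q / 2 * (u i * x 0 i) * x 0 j
      + (q / 2 * x 0 i + (1 - q) * (u i * x 0 i)) * (u j * x 0 j))).
    by rewrite big_split /= -!mulr_sumr -fE x_sum1; ring.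
  by apply: eq_bigr => j _; ring.
rewrite partial_mass_qso_map; apply: ler_sum => i _; apply: ler_sum => j _.
rewrite ler_wpM2r ?mulr_ge0 // /u.
case: (ltnP i r) => ir; case: (ltnP j r) => jr /=.
- by have := block_coef_le1 i j; lra.
- by have := hq _ _ ir jr; lra.
- by rewrite block_coefC; have := hq _ _ jr ir; lra.
- by rewrite block_coef_out //; lra.
Qed.

End OneStep.

Lemma simplex_trajectory (R : realType) (m : nat) (V : qso R m) (x0 : 'rV[R]_m)
  (n : nat) : simplex x0 -> simplex (trajectory V x0 n).
Proof. by move=> x0S; elim: n => //= n; exact: qso_map_simplex. Qed.

(** The contraction factor depends on the starting point: it is the one-step
    factor q + (1 - q) * f evaluated at the largest mass f of the trajectory,
    which is the initial one. *)
Lemma partial_mass_trajectory_contract (R : realType) (m l r : nat)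
    (V : qso R m) (x0 : 'rV[R]_m) :
  l_volterra l V -> (r <= l)%N -> (r < m)%N ->
  (forall k i : 'I_m, (k < r)%N -> (r <= i)%N -> volterra_coef V k i < 0) ->
  int_simplex x0 ->
  exists2 s : R, s < 1 &
    forall n, partial_mass r (trajectory V x0 n.+1)
                <= s * partial_mass r (trajectory V x0 n).
Proof.
move=> hV rl rm a_lt0 x0int; pose f n := partial_mass r (trajectory V x0 n).
have [q q1 hq] := exists_block_rate hV rl a_lt0.
have f_ge0 n : 0 <= f n.
  by apply/partial_mass_ge0/simplex_trajectory; case: x0int.
have f_step n : f n.+1 <= (q + (1 - q) * f n) * f n.
  apply: (partial_mass_qso_map_le hV rl hq).
  by apply: simplex_trajectory; case: x0int.
have f0_lt1 : f 0 < 1 by exact: partial_mass_lt1.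
have s_lt1 : q + (1 - q) * f 0 < 1 by nra.
have f_contract n : f n <= f 0 -> f n.+1 <= (q + (1 - q) * f 0) * f n.
  move=> fn; apply: (le_trans (f_step n)).
  by rewrite ler_wpM2r // lerD2l ler_wpM2l // subr_ge0 ltW.
have f_le0 n : f n <= f 0.
  elim: n => // n IHn; apply: (le_trans (f_contract n IHn)).
  by apply: le_trans IHn; rewrite ler_piMl // ltW.
by exists (q + (1 - q) * f 0) => // n; exact: f_contract.
Qed.

Lemma nneseries_contract_lty (R : realType) (f : nat -> R) (s : R) :
  s < 1 -> (forall n, 0 <= f n) -> (forall n, f n.+1 <= s * f n) ->
  (\sum_(0 <= n <oo) (f n)%:E < +oo)%E.
Proof.
move=> s1 f_ge0 f_step.
(* (1 - s) * f n <= f n - f n.+1, and the right-hand sides telescope. *)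
have tele n : (1 - s) * (\sum_(0 <= k < n) f k) <= f 0 - f n.
  elim: n => [|n IHn]; first by rewrite big_nil mulr0 subrr.
  by rewrite big_nat_recr //= mulrDr; have := f_step n; lra.
apply: (@le_lt_trans _ _ (f 0 / (1 - s))%:E); last exact: ltry.
apply: lime_le; first by apply: is_cvg_nneseries => n _ _; rewrite lee_fin.
apply: nearW => n; rewrite sumEFin lee_fin ler_pdivlMr ?subr_gt0 // mulrC.
by apply: le_trans (tele n) _; rewrite gerBl.
Qed.

Theorem theorem2 (R : realType) (m l r : nat) (V : qso R m)
    (hl : (1 <= l <= m)%N) (hV : l_volterra l V)
    (hr : (1 <= r <= l)%N) (hrm : (r < m)%N)
    (ha : forall k i : 'I_m, (k < r)%N -> (r <= i)%N -> volterra_coef V k i < 0) :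
  lyapunov_function V (@partial_mass R m r) /\
  (forall x0 : 'rV[R]_m, int_simplex x0 ->
     (\sum_(0 <= n <oo) (partial_mass r (trajectory V x0 n))%:E < +oo)%E).
Proof.
have [_ rl] := andP hr.
have f_ge0 x0 n : int_simplex x0 -> 0 <= partial_mass r (trajectory V x0 n).
  by move=> [x0S _]; apply/partial_mass_ge0/simplex_trajectory.
split; last first.
  move=> x0 x0int.
  have [s s1 f_step] := partial_mass_trajectory_contract hV rl hrm ha x0int.
  by apply: nneseries_contract_lty f_step => // n; exact: f_ge0.
split.
  by apply: continuous_subspaceT; exact: continuous_partial_mass.
move=> x0 x0int.
have [s s1 f_step] := partial_mass_trajectory_contract hV rl hrm ha x0int.
pose f n := partial_mass r (trajectory V x0 n).
exists (limn f); apply: nonincreasing_is_cvgn.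
  apply/nonincreasing_seqP => n; apply: (le_trans (f_step n)).
  by rewrite ler_piMl ?f_ge0 // ltW.
by exists 0 => _ [n _ <-]; exact: f_ge0.
Qed.
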